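(* Let $F$ be a totally real number field with adele ring $\mathbb{A}$ and set $I$ of real embeddings, and let $\omega$ be a unitary Hecke character of $\mathbb{A}^\times/F^\times$. For each $\iota\in I$ fix $k_\iota\in\mathbb{N}$ and put $$\varphi_\iota(v_1,v_2)=\exp\left(-\pi(v_1^2+v_2^2)\right)(v_1+iv_2)^{k_\iota}\qquad (v_1,v_2\in\mathbb{R}).$$ Let $\varphi=\varphi_f\times\prod_{\iota\in I}\varphi_\iota\in\mathcal{S}(\mathbb{A}^2)$, where $\varphi_f$ is a locally constant compactly supported function on $\mathbb{A}_f^2$. For real numbers $(\theta_\iota)_{\iota\in I}$ let $\rho\in\mathrm{GL}_2(\mathbb{A})$ be the matrix whose finite part is the identity and whose component at $\iota$ is $\begin{pmatrix}\cos\theta_\iota&\sin\theta_\iota\\-\sin\theta_\iota&\cos\theta_\iota\end{pmatrix}$ for each $\iota\in I$. Then for every $g\in\mathrm{GL}_2(\mathbb{A})$, $$E^{\rm ana}_{\omega,s}(\varphi)(g\rho)=\left(\prod_{\iota\in I}e^{ik_\iota\theta_\iota}\right)E^{\rm ana}_{\omega,s}(\varphi)(g),$$ as an identity between meromorphic functions of $s$.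
   Context: $|\cdot|$ is the idelic norm, $\mathbb{A}_f$ the finite adeles. $\mathcal{S}(\mathbb{A}^2)$ is the space of complex-valued Schwartz-Bruhat functions on $\mathbb{A}^2$ (column vectors). For $\Re(s)>1$, $$E^{\rm ana}_{\omega,s}(\varphi)(g)=|\det g|^{-s}\int_{\mathbb{A}^\times/F^\times}\omega(t)|t|^{2s}\,\Theta(\varphi)(t^{-1}g)\,d^\times t,\qquad \Theta(\varphi)(g)=\sum_{v\in F^2\setminus\{0\}}\varphi(g^{-1}v),$$ where an idele $t$ is identified with the scalar matrix $t\cdot 1_2$; this converges absolutely for $\Re(s)>1$, and for other $s$ the notation denotes the meromorphic continuation to $\mathbb{C}$ (which exists). $d^\times t$ is a fixed Haar measure on $\mathbb{A}^\times$, with the quotient measure on $\mathbb{A}^\times/F^\times$. *)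

(* Defs.v *)
From HB Require Import structures.
From mathcomp Require Import all_boot all_order all_algebra all_field.
From mathcomp Require Import finmap all_classical all_reals all_analysis.
From mathcomp Require Import measurable_realfun complex polyrcf.

Set Implicit Arguments.
Unset Strict Implicit.
Unset Printing Implicit Defensive.

Import Order.TTheory GRing.Theory Num.Theory numFieldNormedType.Exports.

Local Open Scope classical_set_scope.
Local Open Scope quotient_scope.
Local Open Scope ring_scope.

(* Complex numbers are R[i] for R : realType; their topology is carried by the
   alias R[i]^o. *)

(* The finite places of a number field are in bijection with its normalised
   discrete valuations F^* -> Z. The value at 0 (morally +oo) is set to the junk value 0, so that
   distinct inhabitants are distinct valuations; [vge v n x] is the statement
   "n <= v(x)" with the convention v(0) = +oo. *)
Record finPlace (F : fieldType) := FinPlace {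
  pval :> F -> int;
  _ : pval 0 = 0;
  _ : forall x y, x != 0 -> y != 0 -> pval (x * y) = pval x + pval y;
  _ : forall x y, x != 0 -> y != 0 -> x + y != 0 ->
        Num.min (pval x) (pval y) <= pval (x + y);
  _ : exists2 x, x != 0 & pval x = 1 }.

HB.instance Definition _ (F : fieldType) := gen_eqMixin (finPlace F).
HB.instance Definition _ (F : fieldType) := gen_choiceMixin (finPlace F).

Section Completion.
Variables (F : fieldType) (v : finPlace F).

Definition vge (n : int) (x : F) := (x == 0) || (n <= v x).

Lemma pvalM x y : x != 0 -> y != 0 -> v (x * y) = v x + v y.
Proof. by case: v => /= w _ + _ _; apply. Qed.

Lemma pvalD x y : x != 0 -> y != 0 -> x + y != 0 ->
  Num.min (v x) (v y) <= v (x + y).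
Proof. by case: v => /= w _ _ + _; apply. Qed.

Lemma pval1 : v 1 = 0.
Proof.
have := pvalM (oner_neq0 F) (oner_neq0 F); rewrite mulr1 => /eqP.
by rewrite -subr_eq subrr => /eqP.
Qed.

Lemma pvalN x : v (- x) = v x.
Proof.
have [->|x0] := eqVneq x 0; first by rewrite oppr0.
have m0 : -1 != 0 :> F by rewrite oppr_eq0 oner_eq0.
rewrite -mulN1r pvalM//; have : v (-1) + v (-1) = 0.
  by rewrite -pvalM// mulrNN mulr1 pval1.
by move=> /eqP; rewrite -mulr2n mulrn_eq0/= => /eqP ->; rewrite add0r.
Qed.

Lemma vgeM n m x y : vge n x -> vge m y -> vge (n + m) (x * y).
Proof.
rewrite /vge; case: (eqVneq x 0) => [->|x0 /= nx]; first by rewrite mul0r eqxx.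
case: (eqVneq y 0) => [->|y0 /= my]; first by rewrite mulr0 eqxx.
by rewrite pvalM// lerD ?orbT.
Qed.

Lemma vgeD n x y : vge n x -> vge n y -> vge n (x + y).
Proof.
rewrite /vge; case: (eqVneq x 0) => [->|x0 /= nx]; first by rewrite add0r.
case: (eqVneq y 0) => [->|y0 /= ny]; first by rewrite addr0 nx orbT.
case: (eqVneq (x + y) 0) => //= xy0.
by apply: le_trans (pvalD x0 y0 xy0); rewrite le_min nx ny.
Qed.

Lemma vge1 : vge 0 1.
Proof. by rewrite /vge pval1 lexx orbT. Qed.

Lemma vgeN n x : vge n (- x) = vge n x.
Proof. by rewrite /vge oppr_eq0 pvalN. Qed.

Lemma vgeB n x y : vge n x -> vge n y -> vge n (x - y).
Proof. by move=> nx ny; apply: vgeD => //; rewrite vgeN. Qed.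

Lemma vge0 n : vge n 0. Proof. by rewrite /vge eqxx. Qed.

Lemma vge_le n m x : n <= m -> vge m x -> vge n x.
Proof. by rewrite /vge; case: eqP => //= _; exact: le_trans. Qed.

Definition cauchyP (u : nat -> F) := forall N : int, exists n0 : nat,
  forall m n, (n0 <= m)%N -> (n0 <= n)%N -> vge N (u m - u n).

Definition nullP (u : nat -> F) := forall N : int, exists n0 : nat,
  forall n, (n0 <= n)%N -> vge N (u n).

Definition cauchyb : pred (nat -> F) := fun u => `[< cauchyP u >].

Lemma cauchy_bounded u : cauchyP u ->
  exists B n0, forall n, (n0 <= n)%N -> vge B (u n).
Proof.
move=> /(_ 0)[n0 un0]; exists (Num.min 0 (v (u n0))), n0 => n n0n.
rewrite -[u n](subrK (u n0)); apply: vgeD.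
  by apply: vge_le (un0 _ _ n0n (leqnn _)); rewrite ge_min lexx.
by rewrite /vge ge_min lexx !orbT.
Qed.

Lemma cauchyb_subring : subring_closed cauchyb.
Proof.
split.
- apply/asboolP => N; exists 0%N => m n _ _; rewrite subrr; exact: vge0.
- move=> u w /asboolP cu /asboolP cw; apply/asboolP => N.
  have [n0 un0] := cu N; have [m0 wm0] := cw N.
  exists (maxn n0 m0) => m n; rewrite !geq_max => /andP[? ?] /andP[? ?].
  have -> : (u - w) m - (u - w) n = (u m - u n) - (w m - w n).
    rewrite -[(u - w) m]/(u m - w m) -[(u - w) n]/(u n - w n).
    by rewrite !opprD !opprK addrACA.
  by apply: vgeB; [exact: un0|exact: wm0].
- move=> u w /asboolP cu /asboolP cw; apply/asboolP => N.
  have [B [n1 uB]] := cauchy_bounded cu; have [D [m1 wD]] := cauchy_bounded cw.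
  have [n0 un0] := cu (N - D); have [m0 wm0] := cw (N - B).
  exists (maxn (maxn n0 n1) (maxn m0 m1)) => m n.
  rewrite !geq_max => /andP[/andP[? ?] /andP[? ?]] /andP[/andP[? ?] /andP[? ?]].
  have -> : (u * w) m - (u * w) n =
      u m * (w m - w n) + (u m - u n) * w n.
    rewrite -[(u * w) m]/(u m * w m) -[(u * w) n]/(u n * w n).
    by rewrite mulrBr mulrBl addrA subrK.
  apply: vgeD.
    by rewrite -[N](subrK B) addrC; apply: vgeM; [exact: uB|exact: wm0].
  by rewrite -[N](subrK D); apply: vgeM; [exact: un0|exact: wD].
Qed.

HB.instance Definition _ :=
  GRing.isSubringClosed.Build (nat -> F) cauchyb cauchyb_subring.

Record cauchySeq := CauchySeq {
  cseq :> nat -> F;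
  _ : cseq \in cauchyb }.

HB.instance Definition _ := [isSub for cseq].
HB.instance Definition _ := [Choice of cauchySeq by <:].
HB.instance Definition _ := [SubChoice_isSubComNzRing of cauchySeq by <:].

Definition nullb : {pred cauchySeq} := fun u => `[< nullP u >].

Lemma nullb_ideal : idealr_closed nullb.
Proof.
split.
- by apply/asboolP => N; exists 0%N => n _; exact: vge0.
- apply/asboolP => /(_ 1)[n0 /(_ n0 (leqnn _))].
  by rewrite /vge -[cseq 1 n0]/(1 : F) oner_eq0/= pval1.
- move=> a u w /asboolP nu /asboolP nw; apply/asboolP => N.
  have /asboolP ca := valP a.
  have [B [n0 aB]] := cauchy_bounded ca.
  have [n1 un1] := nu (N - B); have [n2 wn2] := nw N.
  exists (maxn n0 (maxn n1 n2)) => n; rewrite !geq_max => /and3P[? ? ?].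
  rewrite -[cseq _ n]/(a n * u n + w n); apply: vgeD; last exact: wn2.
  by rewrite -[N](subrK B) addrC; apply: vgeM; [exact: aB|exact: un1].
Qed.

HB.instance Definition _ :=
  GRing.isZmodClosed.Build cauchySeq nullb (idealr_closedB nullb_ideal).
HB.instance Definition _ :=
  isProperIdeal.Build cauchySeq nullb (idealr_closed_nontrivial nullb_ideal).

(* The completion F_v: Cauchy sequences modulo null sequences. *)
Definition completion := {ideal_quot nullb}.

HB.instance Definition _ := GRing.ComNzRing.on completion.
HB.instance Definition _ := Quotient.on completion.

Definition const_cauchy (x : F) : cauchySeq.
Proof.
exists (fun=> x); apply/asboolP => N; exists 0%N => m n _ _.
by rewrite subrr; exact: vge0.
Defined.

Definition to_completion (x : F) : completion := \pi_completion (const_cauchy x).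

Lemma to_completion1 : to_completion 1 = 1.
Proof.
by rewrite -(rmorph1 \pi_completion); congr (\pi_completion _); exact: val_inj.
Qed.

Lemma to_completionM x y :
  to_completion (x * y) = to_completion x * to_completion y.
Proof.
by rewrite -[RHS]rmorphM; congr (\pi_completion _); exact: val_inj.
Qed.

(* [cge n x] is "n <= v(x)" for the valuation of the completion. *)
Definition cge (n : int) (x : completion) :=
  exists n0 : nat, forall k, (n0 <= k)%N -> vge n (cseq (repr x) k).

Lemma cge_pi n (u : cauchySeq) :
  cge n (\pi_completion u) <->
  exists n0 : nat, forall k, (n0 <= k)%N -> vge n (u k).
Proof.
have : nullP (repr (\pi_completion u) - u).
  have /eqmodP/= : repr (\pi_completion u) = u %[mod completion].
    by rewrite reprK.
  by rewrite Quotient.equivE => /asboolP.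
move=> /(_ n)[n1 un1]; split=> -[n0 h]; exists (maxn n0 n1) => k;
  rewrite geq_max => /andP[/h hk /un1].
  rewrite -[cseq _ k]/(cseq (repr (\pi_completion u)) k - u k) => uk.
  by rewrite -[u k](subKr (cseq (repr (\pi_completion u)) k)); exact: vgeB.
rewrite -[cseq _ k]/(cseq (repr (\pi_completion u)) k - u k) => uk.
by rewrite -[cseq (repr _) k](subrK (u k)); exact: vgeD.
Qed.

Lemma cge1 : cge 0 1.
Proof.
rewrite -(rmorph1 \pi_completion); apply/cge_pi; exists 0%N => k _.
exact: vge1.
Qed.

Lemma cge0 n : cge n 0.
Proof.
rewrite -(rmorph0 \pi_completion); apply/cge_pi; exists 0%N => k _.
exact: vge0.
Qed.

Lemma cgeN n x : cge n x -> cge n (- x).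
Proof.
rewrite -[x]reprK -rmorphN => /cge_pi[n0 h]; apply/cge_pi; exists n0 => k /h.
by rewrite -[cseq (- _) k]/(- _ k) vgeN.
Qed.

Lemma cgeD n x y : cge n x -> cge n y -> cge n (x + y).
Proof.
rewrite -[x]reprK -[y]reprK -rmorphD => /cge_pi[n0 h0] /cge_pi[n1 h1].
apply/cge_pi; exists (maxn n0 n1) => k; rewrite geq_max => /andP[/h0 ? /h1 ?].
exact: vgeD.
Qed.

Lemma cgeM n m x y : cge n x -> cge m y -> cge (n + m) (x * y).
Proof.
rewrite -[x]reprK -[y]reprK -rmorphM => /cge_pi[n0 h0] /cge_pi[n1 h1].
apply/cge_pi; exists (maxn n0 n1) => k; rewrite geq_max => /andP[/h0 ? /h1 ?].
exact: vgeM.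
Qed.

Definition integers : set completion := [set x | cge 0 x].

HB.instance Definition _ := @isSubBaseTopological.Build completion
  (set completion)
  [set B | exists x n, B = [set y | cge n (y - x)]] id.

(* Cardinality of the residue field, as the number of classes of the valuation
   ring of v in F modulo its maximal ideal. *)
Definition residue_card : nat :=
  #|` fset_set [set [set y | vge 1 (y - x)] | x in [set x | vge 0 x]] |.

(* q_v ^ (- v(x)), and 0 at x = 0. *)
Definition cabs (R : realType) (x : completion) : R :=
  inf [set (residue_card%:R : R) ^ (- n) | n in [set n : int | cge n x]].

End Completion.
Arguments integers {F} v.

(* The set I of real embeddings; it is finite because an embedding is determined
   by the images of a basis, which are roots of minimal polynomials. *)
Definition realEmb (F : fieldExtType rat) (R : realType) := {rmorphism F -> R}.

Section RealEmbFinite.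
Variables (F : fieldExtType rat) (R : realType).

Lemma rat_root_exists (x : F) :
  exists p : {poly rat}, p != 0 /\ root (map_poly (in_alg F) p) x.
Proof.
have /polyOver1P[p pE] := minPolyOver 1%AS x; exists p; split; last first.
  by rewrite -pE root_minPoly.
by rewrite -(map_poly_eq0 (in_alg F)) -pE monic_neq0// monic_minPoly.
Qed.

Definition emb_roots : seq R := flatten [seq rootsR
  (map_poly ratr (projT1 (cid (rat_root_exists x)))) | x <- vbasis {:F}].

Lemma emb_rootsP (f : realEmb F R) (i : 'I_(\dim {:F})) :
  (f : {rmorphism F -> R}) (vbasis {:F})`_i \in emb_roots.
Proof.
apply/flatten_mapP; exists (vbasis {:F})`_i; first by rewrite mem_nth ?size_tuple.
case: cid => /= p [p0 px].
rewrite -roots_on_rootsR ?map_poly_eq0//=.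
rewrite -(fmorph_root f) -map_poly_comp in px; move: px.
by rewrite (eq_map_poly (fmorph_eq_rat _)).
Qed.

Definition emb_code (f : realEmb F R) :
    {ffun 'I_(\dim {:F}) -> seq_sub emb_roots} :=
  [ffun i => SeqSub (emb_rootsP f i)].

Lemma emb_ext (f g : realEmb F R) : (f : F -> R) =1 (g : F -> R) -> f = g.
Proof.
case: f g => f [[fa] [fm]] [g [[ga] [gm]]] /= /funext fg.
by case: _ / fg ga gm => ga gm; rewrite (Prop_irrelevance fa ga)
  (Prop_irrelevance fm gm).
Qed.

Lemma emb_alg (f : {rmorphism F -> R}) (q : rat) : f q%:A = ratr q.
Proof. exact: (fmorph_eq_rat (f \o in_alg F)). Qed.

Lemma emb_code_inj : injective emb_code.
Proof.
move=> f g fg; apply: emb_ext => x.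
have fgb (i : 'I_(\dim {:F})) : (f : {rmorphism F -> R}) (vbasis {:F})`_i =
             (g : {rmorphism F -> R}) (vbasis {:F})`_i.
  move/ffunP: fg => /(_ i); rewrite 2!ffunE; exact: (congr1 (@ssval _ _)).
have embE (h : {rmorphism F -> R}) : h x =
    \sum_(i < \dim {:F}) ratr (coord (vbasis {:F}) i x) * h (vbasis {:F})`_i.
  rewrite {1}(coord_vbasis (memvf x)) rmorph_sum/=; apply: eq_bigr => i _.
  by rewrite -mulr_algl rmorphM/= emb_alg.
by rewrite (embE f) (embE g); apply: eq_bigr => i _; rewrite fgb.
Qed.

Definition emb_decode c : option (realEmb F R) :=
  if pselect (exists f, emb_code f = c) is left h then Some (projT1 (cid h))
  else None.

Lemma emb_codeK : pcancel emb_code emb_decode.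
Proof.
move=> f; rewrite /emb_decode; case: pselect => [h|[]]; last by exists f.
by case: cid => g /= /emb_code_inj ->.
Qed.

HB.instance Definition _ := Finite.copy (realEmb F R) (pcan_type emb_codeK).

End RealEmbFinite.

(* A_f: the restricted product of the F_v with respect to their rings of
   integers. *)
Record finAdele (F : fieldType) := FinAdele {
  fa :> forall v : finPlace F, completion v;
  _ : finite_set [set v | ~ integers v (fa v)] }.

HB.instance Definition _ F := gen_eqMixin (finAdele F).
HB.instance Definition _ F := gen_choiceMixin (finAdele F).

Section FinAdele.
Variable F : fieldType.
Implicit Types x y z : finAdele F.

Lemma fa_finite x : finite_set [set v | ~ integers v (x v)].
Proof. by case: x. Qed.

Lemma fa_ext x y : (forall v, x v = y v) -> x = y.
Proof.
case: x y => [x hx] [y hy] /= xy.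
have {xy} e : x = y by exact: functional_extensionality_dep.
by case: _ / e hy => hy; congr FinAdele; exact: Prop_irrelevance.
Qed.

Lemma fa_zeroP : finite_set [set v : finPlace F | ~ integers v 0].
Proof.
by apply: (sub_finite_set _ (finite_set0 _)) => v /=; apply; exact: cge0.
Qed.

Lemma fa_oneP : finite_set [set v : finPlace F | ~ integers v 1].
Proof.
by apply: (sub_finite_set _ (finite_set0 _)) => v /=; apply; exact: cge1.
Qed.

Lemma fa_oppP x : finite_set [set v | ~ integers v (- x v)].
Proof.
apply: (sub_finite_set _ (fa_finite x)) => v /= h hx.
by apply: h; exact: cgeN.
Qed.

Lemma fa_addP x y : finite_set [set v | ~ integers v (x v + y v)].
Proof.
apply: (sub_finite_set (B := [set v | ~ integers v (x v)] `|`
                             [set v | ~ integers v (y v)])); last first.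
  by rewrite finite_setU; split; exact: fa_finite.
move=> v /= h; apply: contrapT => /not_orP[/contrapT hx /contrapT hy].
by apply: h; exact: cgeD.
Qed.

Lemma fa_mulP x y : finite_set [set v | ~ integers v (x v * y v)].
Proof.
apply: (sub_finite_set (B := [set v | ~ integers v (x v)] `|`
                             [set v | ~ integers v (y v)])); last first.
  by rewrite finite_setU; split; exact: fa_finite.
move=> v /= h; apply: contrapT => /not_orP[/contrapT hx /contrapT hy].
by apply: h; rewrite /integers/= -[0]addr0; exact: cgeM.
Qed.

Definition fa_zero : finAdele F := FinAdele fa_zeroP.
Definition fa_one : finAdele F := FinAdele fa_oneP.
Definition fa_opp x : finAdele F := FinAdele (fa_oppP x).
Definition fa_add x y : finAdele F := FinAdele (fa_addP x y).
Definition fa_mul x y : finAdele F := FinAdele (fa_mulP x y).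

Let fa_addA : associative fa_add.
Proof. by move=> x y z; apply: fa_ext => v; exact: addrA. Qed.
Let fa_addC : commutative fa_add.
Proof. by move=> x y; apply: fa_ext => v; exact: addrC. Qed.
Let fa_add0 : left_id fa_zero fa_add.
Proof. by move=> x; apply: fa_ext => v; exact: add0r. Qed.
Let fa_addN : left_inverse fa_zero fa_opp fa_add.
Proof. by move=> x; apply: fa_ext => v; exact: addNr. Qed.
HB.instance Definition _ :=
  GRing.isZmodule.Build (finAdele F) fa_addA fa_addC fa_add0 fa_addN.

Let fa_mulA : associative fa_mul.
Proof. by move=> x y z; apply: fa_ext => v; exact: mulrA. Qed.
Let fa_mulC : commutative fa_mul.
Proof. by move=> x y; apply: fa_ext => v; exact: mulrC. Qed.
Let fa_mul1 : left_id fa_one fa_mul.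
Proof. by move=> x; apply: fa_ext => v; exact: mul1r. Qed.
Let fa_mulD : left_distributive fa_mul +%R.
Proof. by move=> x y z; apply: fa_ext => v; exact: mulrDl. Qed.
HB.instance Definition _ :=
  GRing.Zmodule_isComPzRing.Build (finAdele F) fa_mulA fa_mulC fa_mul1 fa_mulD.

HB.instance Definition _ := @isSubBaseTopological.Build (finAdele F)
  (set (finAdele F))
  [set B | exists U : forall v : finPlace F, set (completion v),
     [/\ forall v, open (U v), finite_set [set v | U v <> integers v] &
         B = [set x : finAdele F | forall v, U v (x v)]]] id.

End FinAdele.

(* The archimedean factor; all archimedean places are real when F is totally
   real, and only then is [adele] below the adele ring of F. *)
Definition infAdele (F : fieldExtType rat) (R : realType) := realEmb F R -> R.

HB.instance Definition _ F R := GRing.ComPzRing.on (infAdele F R).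
HB.instance Definition _ F R :=
  Topological.copy (infAdele F R) {ptws realEmb F R -> R}.

Definition adele (F : fieldExtType rat) (R : realType) :=
  (infAdele F R * finAdele F)%type.

HB.instance Definition _ F R := GRing.ComPzRing.on (adele F R).
HB.instance Definition _ F R := Topological.on (adele F R).

(* [principal x a]: the adele a is the image of x under the diagonal embedding
   of F. A relation avoids having to know that x is integral at almost all v. *)
Definition principal (F : fieldExtType rat) (R : realType) (x : F) (a : adele F R) :=
  (forall f : realEmb F R, a.1 f = (f : {rmorphism F -> R}) x) /\
  (forall v, a.2 v = to_completion v x).

(* The unit group of a ring, as pairs (x, x^-1). *)
Record unitsOf (A : pzRingType) := Units {
  uval :> A;
  uinv : A;
  uvalV : uval * uinv = 1;
  uVval : uinv * uval = 1 }.

HB.instance Definition _ A := gen_eqMixin (unitsOf A).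
HB.instance Definition _ A := gen_choiceMixin (unitsOf A).

Section Units.
Variable A : pzRingType.

Lemma units_ext (x y : unitsOf A) : uval x = uval y -> x = y.
Proof.
case: x y => [x x' xx' x'x] [y y' yy' y'y] /= e; subst y.
have e : x' = y' by rewrite -[x']mulr1 -yy' mulrA x'x mul1r.
by subst y'; congr Units; exact: Prop_irrelevance.
Qed.

Definition unit1 : unitsOf A := Units (mulr1 1) (mulr1 1).

Definition unitV (x : unitsOf A) : unitsOf A := Units (uVval x) (uvalV x).

Lemma unitM_proof (x y : unitsOf A) : uval x * uval y * (uinv y * uinv x) = 1.
Proof. by rewrite mulrA -(mulrA (uval x)) uvalV mulr1 uvalV. Qed.

Lemma unitM_proof' (x y : unitsOf A) : uinv y * uinv x * (uval x * uval y) = 1.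
Proof. by rewrite mulrA -(mulrA (uinv y)) uVval mulr1 uVval. Qed.

Definition unitM (x y : unitsOf A) : unitsOf A :=
  Units (unitM_proof x y) (unitM_proof' x y).

End Units.

(* The topology of A^* is the one induced by x |-> (x, x^-1) from A x A. *)
Definition idele (F : fieldExtType rat) (R : realType) := unitsOf (adele F R).

HB.instance Definition _ F R := Choice.on (idele F R).
HB.instance Definition _ F R := Topological.copy (idele F R)
  (initial_topology (fun x : idele F R => (uval x, uinv x))).
HB.instance Definition _ F R :=
  isPointed.Build (idele F R) (unit1 (adele F R)).

Definition GL2A (F : fieldExtType rat) (R : realType) := unitsOf 'M[adele F R]_2.

Section GL2.
Variables (F : fieldExtType rat) (R : realType).

Lemma gl2_detV (g : GL2A F R) : \det (uval g) * \det (uinv g) = 1.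
Proof. by rewrite -det_mulmx mulmxE uvalV det1. Qed.

Lemma gl2_Vdet (g : GL2A F R) : \det (uinv g) * \det (uval g) = 1.
Proof. by rewrite -det_mulmx mulmxE uVval det1. Qed.

Definition gl2_det (g : GL2A F R) : idele F R := Units (gl2_detV g) (gl2_Vdet g).

Lemma scalar_gl2V (t : idele F R) :
  (uval t)%:M * (uinv t)%:M = 1 :> 'M[adele F R]_2.
Proof. by rewrite -mulmxE -scalar_mxM uvalV. Qed.

Lemma scalar_gl2_V (t : idele F R) :
  (uinv t)%:M * (uval t)%:M = 1 :> 'M[adele F R]_2.
Proof. by rewrite -mulmxE -scalar_mxM uVval. Qed.

Definition scalar_gl2 (t : idele F R) : GL2A F R :=
  Units (scalar_gl2V t) (scalar_gl2_V t).

End GL2.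

(* The second product has finite support, since t_v is a unit of the ring of
   integers for almost all v. *)
Definition idele_norm (F : fieldExtType rat) (R : realType) (t : idele F R) : R :=
  \prod_(f : realEmb F R) `|(uval t).1 f| *
  \big[*%R/1]_(v \in [set: finPlace F]) cabs R ((uval t).2 v).

Section IdeleClass.
Variables (F : fieldExtType rat) (R : realType).

Definition principal_idele : set (idele F R) :=
  [set t | exists2 x : F, x != 0 &
     principal x (uval t) /\ principal x^-1 (uinv t)].

Lemma principal1 : principal_idele (unit1 _).
Proof.
exists 1; rewrite ?oner_neq0// invr1; split; split => /= [f|v];
  by rewrite ?rmorph1 ?to_completion1.
Qed.

Lemma principalV t : principal_idele t -> principal_idele (unitV t).
Proof.
by move=> [x x0 [h1 h2]]; exists x^-1; rewrite ?invr_eq0// invrK; split.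
Qed.

Lemma principalM t u : principal_idele t -> principal_idele u ->
  principal_idele (unitM t u).
Proof.
have pM x y (a b : adele F R) : principal x a -> principal y b ->
    principal (x * y) (a * b).
  move=> [a1 a2] [b1 b2]; split => [f|v].
    by rewrite rmorphM -a1 -b1.
  transitivity (a.2 v * b.2 v); first by [].
  by rewrite a2 b2 to_completionM.
move=> [x x0 [h1 h2]] [y y0 [h3 h4]]; exists (x * y).
  by rewrite mulf_neq0.
by split => /=; [exact: pM|rewrite invfM mulrC; exact: pM].
Qed.

Definition class_rel (t u : idele F R) : bool :=
  `[< principal_idele (unitM t (unitV u)) >].

Lemma class_rel_equiv : equiv_class_of class_rel.
Proof.
split=> [t|t u|u t w]; rewrite /class_rel.
- apply/asboolP; suff -> : unitM t (unitV t) = unit1 _ by exact: principal1.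
  by apply: units_ext; exact: uvalV.
- apply/asboolP/asboolP => /principalV h.
    suff <- : unitV (unitM t (unitV u)) = unitM u (unitV t) by [].
    exact: units_ext.
  suff <- : unitV (unitM u (unitV t)) = unitM t (unitV u) by [].
  exact: units_ext.
- move=> /asboolP h1 /asboolP h2; apply/asboolP.
  suff <- : unitM (unitM t (unitV u)) (unitM u (unitV w)) = unitM t (unitV w).
    exact: principalM.
  by apply: units_ext => /=; rewrite mulrA -(mulrA (uval t)) uVval mulr1.
Qed.

Canonical class_equiv := EquivRelPack class_rel_equiv.
Canonical class_encModRel := defaultEncModRel class_rel.

Definition idele_class := quotient_topology {eq_quot class_rel}.

HB.instance Definition _ := Topological.on idele_class.
HB.instance Definition _ := Quotient.on idele_class.
HB.instance Definition _ := Pointed.on idele_class.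

End IdeleClass.

Notation borel_idele F R := (g_sigma_algebraType (@open (idele F R))).
Notation borel_class F R := (g_sigma_algebraType (@open (idele_class F R))).

Section Haar.
Variables (F : fieldExtType rat) (R : realType).

Definition is_haar (mu : {measure set (borel_idele F R) -> \bar R}) :=
  [/\ forall (x : idele F R) (A : set (borel_idele F R)), measurable A ->
        mu [set unitM x a | a in A] = mu A,
      forall K : set (idele F R), compact K -> (mu K < +oo)%E &
      forall U : set (idele F R), open U -> U !=set0 -> (0 < mu U)%E].

(* nu is the quotient of mu by the counting measure of the discrete subgroup
   F^*, characterised by the unfolding formula
   int_{A^*} f = int_{A^*/F^*} sum_{c in F^*} f(c t). *)
Definition is_quotient_measure
    (mu : {measure set (borel_idele F R) -> \bar R})
    (nu : {measure set (borel_class F R) -> \bar R}) :=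
  forall f : borel_idele F R -> \bar R,
    (forall t, (0 <= f t)%E) -> measurable_fun setT f ->
    (\int[mu]_t f t =
     \int[nu]_x (\esum_(c in @principal_idele F R)
       f (unitM c (repr (x : idele_class F R)))))%E.

End Haar.

Section ComplexAnalysis.
Variable R : realType.
Local Notation C := R[i].
Local Open Scope complex_scope.

(* Unordered sum of an absolutely summable family, and 0 otherwise. *)
Definition rsum (I : choiceType) (D : set I) (f : I -> R) : R :=
  fine (\esum_(i in D) (Num.max (f i) 0)%:E) -
  fine (\esum_(i in D) (Num.max (- f i) 0)%:E).

Definition csum (I : choiceType) (D : set I) (f : I -> C) : C :=
  if `[< summable D (fun i => (complex.Re (f i))%:E) /\
         summable D (fun i => (complex.Im (f i))%:E) >]
  then rsum D (fun i => complex.Re (f i)) +i* rsum D (fun i => complex.Im (f i))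
  else 0.

(* Integral of an absolutely integrable function, and 0 otherwise. *)
Definition cintegral d (T : measurableType d) (nu : {measure set T -> \bar R})
    (f : T -> C) : C :=
  if `[< nu.-integrable setT (fun x => (complex.Re (f x))%:E) /\
         nu.-integrable setT (fun x => (complex.Im (f x))%:E) >]
  then (\int[nu]_x complex.Re (f x)) +i* (\int[nu]_x complex.Im (f x))
  else 0.

Definition cexp (z : C) : C :=
  (expR (complex.Re z))%:C * (cos (complex.Im z) +i* sin (complex.Im z)).

(* x ^ s for x > 0. *)
Definition rcpow (x : R) (s : C) : C := cexp (s * (ln x)%:C).

Definition analytic_at (f : C -> C) (z0 : C) :=
  exists a : nat -> C, \forall z \near (z0 : C^o),
    series (fun n => a n * (z - z0) ^+ n : C^o) @ \oo --> (f z : C^o).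

(* Near each z0, (z - z0)^n f(z) is a power series in z - z0 for some n. The
   values of f at isolated points are irrelevant, hence [mero_eq]. *)
Definition meromorphic (f : C -> C) := forall z0 : C,
  exists (n : nat) (h : C -> C), analytic_at h z0 /\
    \forall z \near (z0 : C^o)^', (z - z0) ^+ n * f z = h z.

Definition mero_eq (f h : C -> C) :=
  forall z0 : C, \forall z \near (z0 : C^o)^', f z = h z.

End ComplexAnalysis.

Section Eisenstein.
Variables (F : fieldExtType rat) (R : realType).
Local Notation C := R[i].
Local Open Scope complex_scope.

Definition totally_real :=
  forall (f : {rmorphism F -> C}) (x : F), complex.Im (f x) = 0.

Definition unitary_hecke (omega : idele F R -> C) :=
  [/\ continuous (omega : idele F R -> C^o),
      forall x y, omega (unitM x y) = omega x * omega y,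
      forall t, principal_idele t -> omega t = 1 &
      forall t, `|omega t| = 1].

Definition Theta (phi : 'cV[adele F R]_2 -> C) (g : GL2A F R) : C :=
  csum [set w : 'cV[adele F R]_2 | exists2 v : 'cV[F]_2, v != 0 &
          forall i, principal (v i 0) (w i 0)]
       (fun w => phi (uinv g *m w)).

(* The integrand is F^*-invariant, so evaluating it at a representative of the
   class is harmless. *)
Definition Eint (nu : {measure set (borel_class F R) -> \bar R})
    (omega : idele F R -> C) (phi : 'cV[adele F R]_2 -> C) (g : GL2A F R)
    (s : C) : C :=
  rcpow (idele_norm (gl2_det g)) (- s) *
  cintegral nu (fun x : borel_class F R =>
    let t : idele F R := repr (x : idele_class F R) in
    omega t * rcpow (idele_norm t) (2 * s) *
    Theta phi (unitM (scalar_gl2 (unitV t)) g)).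

(* The meromorphic continuation of Eint from the half-plane Re(s) > 1, which is
   unique up to [mero_eq]; 0 if there were none. *)
Definition Eana (nu : {measure set (borel_class F R) -> \bar R})
    (omega : idele F R -> C) (phi : 'cV[adele F R]_2 -> C) (g : GL2A F R) :
    C -> C :=
  xget (fun=> 0) [set E : C -> C | meromorphic E /\
    forall s, 1 < complex.Re s -> E s = Eint nu omega phi g s].

Definition phi_real (k : nat) (v1 v2 : R) : C :=
  (expR (- pi * (v1 ^+ 2 + v2 ^+ 2)))%:C * (v1 +i* v2) ^+ k.

Definition phi_adelic (phi_f : 'cV[finAdele F]_2 -> C) (k : realEmb F R -> nat)
    (w : 'cV[adele F R]_2) : C :=
  phi_f (\col_i (w i 0).2) *
  \prod_(f : realEmb F R) phi_real (k f) ((w 0 0).1 f) ((w 1 0).1 f).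

Definition locally_constant (T : topologicalType) (f : T -> C) :=
  forall x, \forall y \near x, f y = f x.

Definition compactly_supported (T : topologicalType) (f : T -> C) :=
  compact (closure [set x | f x != 0]).

Definition rot (a : R) : 'M[R]_2 :=
  \matrix_(i < 2, j < 2)
    if i == 0 then (if j == 0 then cos a else sin a)
    else (if j == 0 then - sin a else cos a).

Definition adelic_rot (theta : realEmb F R -> R) : 'M[adele F R]_2 :=
  \matrix_(i < 2, j < 2)
    ((fun f => rot (theta f) i j) : infAdele F R,
     (1%:M : 'M[finAdele F]_2) i j).

Lemma rotVM (a : R) : rot a *m rot (- a) = 1.
Proof.
apply/matrixP => i j; rewrite !mxE !big_ord_recl big_ord0 !mxE addr0 cosN sinN.
have cs := cos2Dsin2 a; rewrite !expr2 in cs.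
case: i => -[|[|//]] ?; case: j => -[|[|//]] ?; rewrite /= ?opprK.
- exact: cs.
- by rewrite mulrN [sin a * _]mulrC addNr.
- by rewrite mulNr [sin a * _]mulrC addNr.
- by rewrite mulrNN addrC.
Qed.

Lemma adelic_rotM theta :
  adelic_rot theta * adelic_rot (\- theta) = 1.
Proof.
apply/matrixP => i j; rewrite -mulmxE !mxE !big_ord_recl big_ord0 !mxE addr0.
apply/pair_eqP => /=; apply/andP; split; apply/eqP.
  apply/funext => f; transitivity ((rot (theta f) *m rot (- theta f)) i j).
    by rewrite [RHS]mxE !big_ord_recl big_ord0 addr0.
  by rewrite rotVM mxE; case: (i == j).
transitivity ((1%:M *m 1%:M : 'M[finAdele F]_2) i j).
  by rewrite [RHS]mxE !big_ord_recl big_ord0 addr0 !mxE.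
by rewrite mul1mx mxE; case: (i == j).
Qed.

Lemma adelic_rotNM theta :
  adelic_rot (\- theta) * adelic_rot theta = 1.
Proof.
rewrite -[X in _ * adelic_rot X](_ : \- (\- theta) = theta).
  exact: adelic_rotM.
by apply/funext => f; exact: opprK.
Qed.

Definition adelic_rotation (theta : realEmb F R -> R) : GL2A F R :=
  Units (adelic_rotM theta) (adelic_rotNM theta).

End Eisenstein.

(* Main.v *)
(* At each real place the rotation multiplies v1 + i v2 by e^(i theta) and
   preserves v1^2 + v2^2, so phi (rho^-1 w) = c phi(w) with c the product of the
   e^(i k theta); moreover det rho = 1. Hence the integral at g rho is c times the
   one at g for every s, including the junk value 0 of a divergent sum or integral
   because c != 0. [Eana] picks an arbitrary continuation, so the identity passes
   to it by uniqueness of meromorphic continuation from the half-plane Re s > 1. *)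
Require Import Defs.
From mathcomp Require Import all_boot all_order all_algebra all_field.
From mathcomp Require Import all_classical all_reals all_analysis complex ring.
Import Order.TTheory GRing.Theory Num.Theory numFieldNormedType.Exports.
Local Open Scope classical_set_scope.
Local Open Scope ring_scope.

(** * Isolation of the zeros of a power series *)

(** Close to [z0] the leading term [a m * (z - z0) ^+ m] outweighs the tail, which is dominated by a
    geometric series because the terms at [z1] are bounded. *)
Lemma power_series_neq0_near (K : numFieldType) (a : nat -> K) (m : nat) (z0 z1 : K) :
  a m != 0 -> (forall i, (i < m)%N -> a i = 0) -> z1 != z0 ->
  cvgn (series (fun n => a n * (z1 - z0) ^+ n : K^o)) ->
  \forall z \near (z0 : K^o)^', forall l : K,
    series (fun n => a n * (z - z0) ^+ n : K^o) @ \oo --> (l : K^o) -> l != 0.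
Proof.
move=> am a0 z10 cv.
set r := `|z1 - z0|; have r0 : 0 < r by rewrite normr_gt0 subr_eq0.
have [M [M0 aM]] : exists M : K, 0 < M /\ forall n, `|a n| * r ^+ n <= M.
  have /cvg_series_cvg_0/cvgP/cvg_seq_bounded/pinfty_ex_gt0[M M0 h] := cv.
  by exists M; split => // n; rewrite -normrX -normrM; exact: h.
have am0 : 0 < `|a m| by rewrite normr_gt0.
near=> z => l cvl; apply/eqP => l0; move: cvl; rewrite {}l0 => cvl.
have z0z : z != z0 by near: z; exact: nbhs_dnbhs_neq.
set w := z - z0 in cvl; have w0 : 0 < `|w| by rewrite normr_gt0 subr_eq0.
(* The bound [wr] makes the ratio [q] at most 1/2; [wd], multiplied by [|w|^m / r^(m+1)], says that
   the leading term exceeds twice [M * q ^+ m.+1]. *)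
have wr : `|w| * 2 <= r.
  rewrite -ler_pdivlMr// -normrN opprB ltW//; near: z.
  by apply: nbhs_dnbhs; apply: nbhsx_ballx; rewrite divr_gt0.
have wd : 2 * M * `|w| < `|a m| * r ^+ m.+1.
  rewrite mulrC -ltr_pdivlMr ?mulr_gt0// -normrN opprB; near: z.
  by apply: nbhs_dnbhs; apply: nbhsx_ballx; rewrite divr_gt0 ?mulr_gt0 ?exprn_gt0.
set q := `|w| / r; have q0 : 0 < q by rewrite divr_gt0.
have q2 : 2 * q <= 1 by rewrite mulrA ler_pdivrMr// mul1r mulrC.
have aq n : `|a n * w ^+ n| <= M * q ^+ n.
  rewrite normrM normrX -[`|w|](divfK (lt0r_neq0 r0)) -/q exprMn.
  by rewrite mulrCA mulrC ler_wpM2r ?aM// exprn_ge0// ltW.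
set S := series _ in cvl.
(* [S n] sums the indices below [n], so [S m] vanishes and [S m.+1] is the leading term alone. *)
have Sm : S m = 0.
  by rewrite /S /series/= big_nat big1// => i /a0 ->; rewrite mul0r.
(* The factor [2 - 2 * q ^+ N] stands in for the exact geometric sum: the induction then closes by
   [2 * q <= 1]. *)
have tail N : `|S (m.+1 + N)%N - a m * w ^+ m| <=
    M * q ^+ m.+1 * (2 - 2 * q ^+ N).
  elim: N => [|N IH].
    rewrite addn0 expr0 mulr1 subrr mulr0 /S /series/= big_nat_recr//=.
    by move: Sm; rewrite /S /series/= => ->; rewrite add0r subrr normr0.
  have -> : S (m.+1 + N.+1)%N - a m * w ^+ m =
      (S (m.+1 + N)%N - a m * w ^+ m) + a (m.+1 + N)%N * w ^+ (m.+1 + N).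
    by rewrite addnS /S /series/= big_nat_recr//= addrAC.
  apply: le_trans (ler_normD _ _) _; apply: le_trans (lerD IH (aq _)) _.
  rewrite exprD mulrA -mulrDr ler_wpM2l ?mulr_ge0 ?exprn_ge0 ?(ltW M0) ?(ltW q0)//.
  rewrite exprS -subr_ge0.
  have -> : 2 - 2 * (q * q ^+ N) - (2 - 2 * q ^+ N + q ^+ N) =
    (1 - 2 * q) * q ^+ N by ring.
  by rewrite mulr_ge0 ?subr_ge0 ?exprn_ge0 ?(ltW q0).
set e := `|a m| * `|w| ^+ m - M * q ^+ m.+1 * 2.
have e0 : 0 < e.
  have -> : e = `|w| ^+ m / r ^+ m.+1 * (`|a m| * r ^+ m.+1 - 2 * M * `|w|).
    rewrite /e /q expr_div_n [`|w| ^+ m.+1]exprS mulrBr; congr (_ - _); last by ring.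
    by rewrite mulrCA mulrA mulrA mulfVK// expf_neq0 ?lt0r_neq0.
  by rewrite mulr_gt0 ?subr_gt0// divr_gt0 ?exprn_gt0.
(* A limit 0 would put some [S n] with [n > m] below [e] in norm, whereas [tail] keeps its norm at
   least [e]. *)
have /cvgrPdist_lt/(_ _ e0) := cvl.
move=> [N _ /(_ (m.+1 + N)%N (leq_addl _ _))] /=; rewrite sub0r normrN.
rewrite -/S => SN.
have : `|a m| * `|w| ^+ m <= `|S (m.+1 + N)%N| + M * q ^+ m.+1 * 2.
  rewrite -normrX -normrM -[a m * _](subKr (S (m.+1 + N)%N)).
  apply: le_trans (ler_normB _ _) _; rewrite lerD2l.
  apply: le_trans (tail N) _.
  rewrite ler_wpM2l ?mulr_ge0 ?exprn_ge0 ?(ltW M0) ?(ltW q0)//.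
  by rewrite gerBl mulr_ge0 ?exprn_ge0 ?(ltW q0).
by rewrite -lerBlDr -/e => /(lt_le_trans SN); rewrite ltxx.
Unshelve. all: end_near.
Qed.

(** * Meromorphic functions and the identity theorem *)

Section Meromorphic.
Variable R : realType.
Local Notation C := R[i].
Implicit Types (f h : C -> C) (z : C) (c : C).

(** Either every coefficient vanishes, or the first nonzero one governs the behaviour near [z0]. *)
Lemma analytic_at_zero_isolated {h z0} : analytic_at h z0 ->
  (\forall z \near (z0 : C^o), h z = 0) \/
  (\forall z \near (z0 : C^o)^', h z != 0).
Proof.
move=> [a ha]; have [a0|] := pselect (forall n, a n = 0).
  left; near=> z.
  have : series (fun n => a n * (z - z0) ^+ n : C^o) @ \oo --> (h z : C^o).
    by near: z.
  rewrite (_ : series _ = fun=> 0); last first.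
    by apply/funext => n; rewrite /series/= big1// => i _; rewrite a0 mul0r.
  by move=> /cvg_lim <-//; rewrite lim_cst.
move=> /existsNP[n0 an0]; right.
have ex : exists n, a n != 0 by exists n0; exact/eqP.
have [m am mmin] := ex_minnP ex.
have a0 i : (i < m)%N -> a i = 0.
  by move=> im; apply: contraTeq im => /mmin; rewrite -leqNgt.
(* A convergence point other than [z0] exists because punctured neighbourhoods are nonempty. *)
have [z1 [z10 cv]] : exists z1 : C, z1 != z0 /\
    cvgn (series (fun n => a n * (z1 - z0) ^+ n : C^o)).
  suff : \forall z \near (z0 : C^o)^', z != z0 /\
    cvgn (series (fun n => a n * (z - z0) ^+ n : C^o))
    by apply: (@filter_ex _ _ (Proper_dnbhs_regular_numFieldType z0)).
  near=> z; split; first by near: z; exact: (@nbhs_dnbhs_neq C^o).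
  apply: (@cvgP _ _ (h z : C^o)); near: z; exact: nbhs_dnbhs.
have := power_series_neq0_near _ _ _ _ _ am a0 z10 cv.
apply: filter_app; near=> z; apply; near: z; exact: nbhs_dnbhs.
Unshelve. all: end_near.
Qed.

Lemma analytic_at_lin {f h z0} c : analytic_at f z0 -> analytic_at h z0 ->
  analytic_at (fun z => f z + c * h z) z0.
Proof.
move=> [a fa] [b hb]; exists (fun n => a n + c * b n).
apply: filterS2 fa hb => z cf ch.
rewrite (_ : series _ = series (fun n => a n * (z - z0) ^+ n : C^o) +
    c *: series (fun n => b n * (z - z0) ^+ n : C^o)).
  exact: (@cvgD C C^o _ _ _ _ _ _ _ cf (@cvgZl_tmp C C^o _ _ _ c _ _ ch)).
rewrite -seriesZ; apply/funext => n; rewrite /series/=.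
by rewrite -[RHS]big_split/=; apply: eq_bigr => i _; rewrite mulrDl -mulrA.
Qed.

(** Serves to bring two expansions with different pole orders to a common power of [z - z0]. *)
Lemma analytic_at_mulX {h z0} n : analytic_at h z0 ->
  analytic_at (fun z => (z - z0) ^+ n * h z) z0.
Proof.
move=> ha; elim: n => [|n [a IH]].
  by under [X in analytic_at X]funext do rewrite mul1r.
(* Multiplication by [z - z0] shifts the coefficients by one, so the partial sums are compared after
   a shift of their index. *)
exists (fun k => if k is k'.+1 then a k' else 0).
apply: filterS IH => z IH.
rewrite -cvg_shiftS; set u := (X in X @ _ --> _).
have -> : u = (z - z0) *: series (fun n => a n * (z - z0) ^+ n : C^o).
  rewrite -seriesZ; apply/funext => k; rewrite /u /series/=.
  by rewrite big_nat_recl//= mul0r add0r; apply: eq_bigr => i _; rewrite exprS mulrCA.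
by rewrite exprS -mulrA; exact: (@cvgZl_tmp C C^o).
Qed.

Lemma meromorphic_lin {f h} c : meromorphic f -> meromorphic h ->
  meromorphic (fun z => f z + c * h z).
Proof.
move=> mf mh z0; have [n [f' [f'a ff']]] := mf z0.
have [m [h' [h'a hh']]] := mh z0.
exists (n + m)%N; exists (fun z => (z - z0) ^+ m * f' z + c * ((z - z0) ^+ n * h' z)).
split; first by apply: analytic_at_lin; exact: analytic_at_mulX.
near=> z; rewrite -(near ff' z)// -(near hh' z)// exprD; ring.
Unshelve. all: end_near.
Qed.

Lemma meromorphic0 : meromorphic (fun=> 0 : C).
Proof.
move=> z0; exists 0%N, (fun=> 0); split; last by near=> z; rewrite mulr0.
exists (fun=> 0); near=> z.
rewrite (_ : series _ = fun=> 0); first exact: cvg_cst.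
by apply/funext => n; rewrite /series/= big1// => i _; rewrite mul0r.
Unshelve. all: end_near.
Qed.

Lemma meromorphicZ {f} c : meromorphic f -> meromorphic (fun z => c * f z).
Proof.
move=> mf; have := meromorphic_lin c meromorphic0 mf.
by congr meromorphic; apply/funext => z; rewrite add0r.
Qed.

(** The neighbourhood is punctured to match [mero_eq]: two functions agree in that sense when this
    set, taken for their difference, is everything. *)
Let zero_near f : set C^o := [set z0 | \forall z \near (z0 : C^o)^', f z = 0].

Lemma near_neq {z0 z1} : z0 != z1 -> \forall z \near (z0 : C^o), z != z1.
Proof.
rewrite -subr_eq0 -normr_gt0 => z01; apply/nbhs_ballP; exists `|z0 - z1| => //= z.
by rewrite -ball_normE/=; apply: contraTneq => ->; rewrite ltxx.
Qed.

Lemma nbhs_in_ball {z0 z1} {e : C} : 0 < e -> ball (z0 : C^o) e z1 ->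
  nbhs (z1 : C^o) (ball (z0 : C^o) e).
Proof.
by move=> e0 z1e; apply: open_nbhs_nbhs; split=> //; exact: (@ball_open C C^o).
Qed.

(** A punctured ball is open, so it contains a full neighbourhood of each of its points. *)
Lemma zero_near_open f : open (zero_near f).
Proof.
rewrite openE => z0 /nbhs_ballP[e /= e0 fe].
apply/nbhs_ballP; exists e => //= z1 z1e.
have [->|z10] := eqVneq z1 z0; first by apply/nbhs_ballP; exists e.
apply: nbhs_dnbhs; apply: filterS2 (nbhs_in_ball e0 z1e) (near_neq z10) => z.
exact: fe.
Qed.

(** At a limit point [z0], some [(z - z0)^n f(z)] extends to an analytic function, which is locally
    zero or has no zero in a punctured neighbourhood; points of the set close to [z0] exclude the
    second case. *)
Lemma zero_near_closed f : meromorphic f -> closed (zero_near f).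
Proof.
move=> mf z0 cz0; have [n [h [ha fh]]] := mf z0.
have [h0|hN0] := analytic_at_zero_isolated ha.
  apply: filterS3 fh (nbhs_dnbhs h0) (@nbhs_dnbhs_neq C^o z0) => z fh hz0 zz0.
  by move/eqP: fh; rewrite hz0 mulf_eq0 expf_eq0 subr_eq0 (negbTE zz0) andbF/= => /eqP.
exfalso.
have fN0 : \forall z \near (z0 : C^o)^', f z != 0.
  apply: filterS2 fh hN0 => z <-; by rewrite mulf_eq0 negb_or => /andP[].
have [e /= e0 fe] := (iffLR (nbhs_ballP _ _) fN0).
(* [z1] may be [z0] itself, hence the case split in [f1]; either way [f] would be both zero and
   nonzero around [z1]. *)
have [z1 [z1f z1e]] := cz0 _ (@nbhsx_ballx C C^o z0 e e0).
have f1 : \forall z \near (z1 : C^o)^', f z != 0.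
  have [->//|z10] := eqVneq z1 z0.
  apply: nbhs_dnbhs; apply: filterS2 (nbhs_in_ball e0 z1e) (near_neq z10) => z.
  exact: fe.
have : \forall z \near (z1 : C^o)^', False.
  by apply: filterS2 z1f f1 => z ->; rewrite eqxx.
by move=> /(@filter_ex _ _ (Proper_dnbhs_regular_numFieldType z1))[].
Qed.

Lemma line_continuous z0 z1 :
  continuous (fun t : R => z0 + t%:C%C * z1 : C^o).
Proof.
move=> t; apply/(@cvgrPdist_lt C C^o) => e e0.
(* The summand 1 covers [z1 = 0]. The tolerance [e] lies in [C], so the radius on the real line is
   taken as a real part. *)
have z10 : 0 < `|z1| + 1 by rewrite ltr_wpDl.
have d0 : 0 < complex.Re (e / (`|z1| + 1)).
  by have := divr_gt0 e0 z10; rewrite ltcE => /andP[].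
near=> u.
rewrite opprD addrACA subrr add0r -mulrBl normrM -rmorphB.
apply: (@le_lt_trans _ _ (`|(t - u)%:C%C| * (`|z1| + 1))).
  by rewrite ler_wpM2l// lerDl.
rewrite -ltr_pdivlMr// -[e / _]RRe_real; last by rewrite gtr0_real// divr_gt0.
rewrite normc_def/= expr0n/= addr0 sqrtr_sqr ltcR.
near: u; exact: (@nbhsx_ballx R R^o t _ d0).
Unshelve. all: end_near.
Qed.

Lemma half_plane_nbhs (A : R) z : A < complex.Re z ->
  \forall w \near (z : C^o), A < complex.Re w.
Proof.
(* The radius is the distance from [z] to the boundary line. *)
move=> Az; apply/nbhs_ballP; exists (complex.Re z - A)%:C%C => /=.
  by rewrite ltcR subr_gt0.
move=> w; rewrite -ball_normE/= => /(le_lt_trans (normc_ge_Re _)).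
rewrite ltcR => /(le_lt_trans (ler_norm _)).
by rewrite raddfB/= ltrD2l ltrN2.
Qed.

(* The points around which [f - h] vanishes form a clopen set; it is pulled back
   to a real line joining [z0] to the half-plane, since R is connected. *)
Lemma meromorphic_identity {f h} (A : R) : meromorphic f -> meromorphic h ->
  (forall z, A < complex.Re z -> f z = h z) -> mero_eq f h.
Proof.
move=> mf mh fh z0.
pose d z := f z + (-1) * h z; have md : meromorphic d := meromorphic_lin (-1) mf mh.
suff : zero_near d z0.
  by apply: filterS => z /eqP; rewrite /d mulN1r subr_eq0 => /eqP.
(* The line passes through [z0] at [t = 0] and through [A + 1], inside the half-plane, at
   [t = 1]. *)
pose w : C := (A + 1)%:C%C - z0.
pose p := fun t : R => z0 + t%:C%C * w : C^o.
have pT : p @^-1` (zero_near d) = setT.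
  have : connected [set: R] by apply/connected_intervalP => x y.
  apply.
  - exists 1; rewrite /= /p mul1r addrC subrK.
    have : A < complex.Re ((A + 1)%:C%C : C) by rewrite /= ltrDl.
    move=> /half_plane_nbhs/nbhs_dnbhs; apply: filterS => z /fh.
    by rewrite /d => ->; rewrite mulN1r subrr.
  - exists (p @^-1` zero_near d); last by rewrite setTI.
    apply: open_comp; [by move=> t _; exact: line_continuous|exact: zero_near_open].
  - exists (p @^-1` zero_near d); last by rewrite setTI.
    apply: closed_comp; [by move=> t _; exact: line_continuous|exact: zero_near_closed].
have : (p @^-1` (zero_near d)) 0 by rewrite pT.
by rewrite /= /p mul0r addr0.
Qed.

End Meromorphic.

(** * Continuations of proportional functions *)

Section Continuation.
Variable R : realType.
Local Notation C := R[i].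

(** For [A := 1] and [I] the Eisenstein integral, this is the set from which [Eana] picks a
    member. *)
Definition continuations (A : R) (I : C -> C) : set (C -> C) :=
  [set E | meromorphic E /\ forall s, A < complex.Re s -> E s = I s].

(** Scaling by [c] and by [c^-1] exchanges the continuations of [I] and of [J], so both sets are
    empty or neither is; when they are not, the identity theorem makes the arbitrary choices
    agree. *)
Lemma continuation_scale (A : R) (I J : C -> C) (c : C) : c != 0 ->
  (forall s, J s = c * I s) ->
  mero_eq (xget (fun=> 0) (continuations A J))
          (fun s => c * xget (fun=> 0) (continuations A I) s).
Proof.
move=> c0 JI; case: xgetP => [E _ [Em EJ]|EJ].
  case: xgetP => [E' _ [E'm E'I]|E'I].
    apply: (meromorphic_identity _ A Em (meromorphicZ _ c E'm)) => s s1.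
    by rewrite EJ// JI E'I.
  (* If only [J] had a continuation, dividing it by [c] would continue [I]. *)
  case: (E'I (fun s => c^-1 * E s)); split; first exact: meromorphicZ.
  by move=> s s1; rewrite EJ// JI mulKf.
case: xgetP => [E' _ [E'm E'I]|_].
  case: (EJ (fun s => c * E' s)); split; first exact: meromorphicZ.
  by move=> s s1; rewrite E'I// JI.
(* With no continuation on either side, both choices are the default 0. *)
by move=> z0; apply: nearW => z; rewrite mulr0.
Qed.

End Continuation.

(** * Linearity of unordered sums and of integrals *)

Section ComplexSums.
Variable R : realType.
Local Notation C := R[i].

Lemma ge0_esumZl (T : choiceType) (D : set T) (f : T -> \bar R) (r : R) :
  0 <= r -> (forall i, 0 <= f i)%E ->
  (\esum_(i in D) (r%:E * f i) = r%:E * \esum_(i in D) f i)%E.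
Proof.
move=> r0 f0; rewrite /esum -ereal_supZl//; last first.
  by apply/set0P; exists (\sum_(x \in set0) f x)%E; exists set0 => //; exact: fsets_set0.
congr ereal_sup; rewrite image_comp; apply: eq_imagel => A _ /=.
by rewrite ge0_mule_fsumr.
Qed.

Section RealSums.
Variables (T : choiceType) (D : set T).
Implicit Types (f g p n : T -> R) (r : R).

Lemma summableZl {f} r : summable D (fun i => (f i)%:E) ->
  summable D (fun i => (r * f i)%:E).
Proof.
rewrite !summableE => sf.
rewrite (eq_esum (b := fun i => (`|r|%:E * `|(f i)%:E|)%E)); last first.
  by move=> i _; rewrite EFinM abseM.
by rewrite ge0_esumZl// fin_numM.
Qed.

Lemma summable_max0 {f} : summable D (fun i => (f i)%:E) ->
  summable D (fun i => (Num.max (f i) 0)%:E).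
Proof.
apply: le_lt_trans; apply: le_esum => i _ /=.
rewrite lee_fin; case: (leP (f i) 0) => //.
by rewrite normr0.
Qed.

Lemma esum_fin_num {f} : (forall i, 0 <= f i) -> summable D (fun i => (f i)%:E) ->
  (\esum_(i in D) (f i)%:E)%E \is a fin_num.
Proof.
move=> f0; rewrite summableE; congr (_ \is a fin_num); apply: eq_esum => i _.
by rewrite gee0_abs ?lee_fin.
Qed.

Let fsum f := fine (\esum_(i in D) (f i)%:E).

Let fsumD f g : (forall i, 0 <= f i) -> (forall i, 0 <= g i) ->
  summable D (fun i => (f i)%:E) -> summable D (fun i => (g i)%:E) ->
  fsum (fun i => f i + g i) = fsum f + fsum g.
Proof.
move=> f0 g0 sf sg; rewrite /fsum -fineD ?esum_fin_num//; congr fine.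
by rewrite -esumD// => i _; rewrite lee_fin.
Qed.

Let fsumZ r f : 0 <= r -> (forall i, 0 <= f i) ->
  summable D (fun i => (f i)%:E) -> fsum (fun i => r * f i) = r * fsum f.
Proof.
move=> r0 f0 sf; rewrite /fsum -[r in RHS]/(fine r%:E) -fineM ?esum_fin_num//.
by rewrite -ge0_esumZl.
Qed.

(** [rsum] is defined by the canonical positive and negative parts; allowing any nonnegative
    summable [p] and [n] reduces linearity to sums of nonnegative families. *)
Lemma rsum_split p n : (forall i, 0 <= p i) -> (forall i, 0 <= n i) ->
  summable D (fun i => (p i)%:E) -> summable D (fun i => (n i)%:E) ->
  rsum D (fun i => p i - n i) = fsum p - fsum n.
Proof.
move=> p0 n0 sp sn.
have sd : summable D (fun i => (p i - n i)%:E) by exact: summableB sp sn.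
have sd' : summable D (fun i => (- (p i - n i))%:E).
  by under eq_fun do rewrite opprB; exact: summableB sn sp.
rewrite /rsum /fsum -!fineB.
(* [esumB] is phrased with the positive and negative parts of [p - n], which are the two maxima in
   [rsum]. *)
- congr fine; rewrite -[RHS]esumB// => [|i _|i _]; rewrite ?lee_fin//.
  congr (_ - _)%E; apply: eq_esum => i _.
    by rewrite funeposE -EFinB EFin_max.
  by rewrite funenegE -EFinB -EFinN EFin_max.
all: apply: esum_fin_num => //.
all: by [exact: summable_max0|move=> i; rewrite le_max lexx orbT].
Qed.

Lemma max0BN (x : R) : x = Num.max x 0 - Num.max (- x) 0.
Proof.
have [x0|/ltW x0] := leP 0 x; first by rewrite max_r ?oppr_le0// subr0.
by rewrite max_l ?oppr_ge0// sub0r opprK.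
Qed.

Let max0_ge0 f i : 0 <= Num.max (f i) 0.
Proof. by rewrite le_max lexx orbT. Qed.

Lemma rsumD f g : summable D (fun i => (f i)%:E) ->
  summable D (fun i => (g i)%:E) ->
  rsum D (fun i => f i + g i) = rsum D f + rsum D g.
Proof.
move=> sf sg.
have sNf : summable D (fun i => (- f i)%:E) by have := sf; rewrite summableN.
have sNg : summable D (fun i => (- g i)%:E) by have := sg; rewrite summableN.
rewrite [X in rsum D X](_ : _ = fun i => (Num.max (f i) 0 + Num.max (g i) 0) -
    (Num.max (- f i) 0 + Num.max (- g i) 0)); last first.
  by apply/funext => i; rewrite opprD addrACA -!max0BN.
rewrite rsum_split => [|i|i||].
- by rewrite !fsumD//; do ?[exact: max0_ge0|exact: summable_max0]; rewrite opprD addrACA.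
- by rewrite addr_ge0.
- by rewrite addr_ge0// (max0_ge0 (\- _)).
- exact: summableD (summable_max0 sf) (summable_max0 sg).
- exact: summableD (summable_max0 sNf) (summable_max0 sNg).
Qed.

Lemma rsumN f : rsum D (fun i => - f i) = - rsum D f.
Proof.
by rewrite /rsum; under [in X in _ - X]eq_esum do rewrite opprK; rewrite opprB.
Qed.

Lemma rsumZl r f : summable D (fun i => (f i)%:E) ->
  rsum D (fun i => r * f i) = r * rsum D f.
Proof.
(* A nonnegative factor respects positive and negative parts; a negative one is reduced to it by
   [rsumN]. *)
wlog r0 : r / 0 <= r => [hr sf|sf].
  have [|/ltW r0] := leP 0 r; first by move=> /hr; apply.
  have -> : (fun i => r * f i) = (fun i => - (- r * f i)).
    by apply/funext => i; rewrite mulNr opprK.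
  by rewrite rsumN hr ?oppr_ge0// mulNr opprK.
have sNf : summable D (fun i => (- f i)%:E) by have := sf; rewrite summableN.
rewrite [X in rsum D X](_ : _ = fun i => r * Num.max (f i) 0 - r * Num.max (- f i) 0).
  rewrite rsum_split => [|i|i||].
  - by rewrite !fsumZ//; do ?[exact: max0_ge0|exact: summable_max0]; rewrite mulrBr.
  - by rewrite mulr_ge0.
  - by rewrite mulr_ge0// (max0_ge0 (\- _)).
  - exact: summableZl (summable_max0 sf).
  - exact: summableZl (summable_max0 sNf).
by apply/funext => i; rewrite -mulrBr -max0BN.
Qed.
End RealSums.
Arguments summableZl {T D f}.

Lemma ReM (z w : C) : complex.Re (z * w) =
  complex.Re z * complex.Re w - complex.Im z * complex.Im w.
Proof. by case: z w => ? ? [? ?]. Qed.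

Lemma ImM (z w : C) : complex.Im (z * w) =
  complex.Re z * complex.Im w + complex.Im z * complex.Re w.
Proof. by case: z w => ? ? [? ?]. Qed.

Lemma complex_mulE (z : C) (x y : R) : z * (x +i* y)%C =
  ((complex.Re z * x - complex.Im z * y) +i*
   (complex.Re z * y + complex.Im z * x))%C.
Proof. by case: z. Qed.

(** As [c] is invertible, [c * f] is summable exactly when [f] is, so the default 0 occurs on both
    sides together. Otherwise real and imaginary parts are expanded. *)
Lemma csumZl (T : choiceType) (D : set T) (f : T -> C) (c : C) : c != 0 ->
  csum D (fun i => c * f i) = c * csum D f.
Proof.
pose sm (g : T -> C) := summable D (fun x => (complex.Re (g x))%:E) /\
  summable D (fun x => (complex.Im (g x))%:E).
have smZ (a : C) g : sm g -> sm (fun x => a * g x).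
  move=> [gr gi]; split.
  - under eq_fun do rewrite ReM.
    exact: summableB (summableZl (complex.Re a) gr) (summableZl (complex.Im a) gi).
  - under eq_fun do rewrite ImM.
    exact: summableD (summableZl (complex.Re a) gi) (summableZl (complex.Im a) gr).
move=> c0; rewrite /csum; case: asboolP => h1; case: asboolP => h2.
- have [fr fi] := h2; rewrite complex_mulE -!rsumZl// -rsumD ?summableZl//.
  rewrite -rsumN -rsumD ?summableZl//; last first.
    by have := summableZl (complex.Im c) fi; rewrite summableN.
  by congr (_ +i* _)%C; congr rsum; apply/funext => x; rewrite ?ReM ?ImM.
- case: h2; have := smZ c^-1 _ h1; congr sm.
  by apply/funext => x; rewrite mulKf.
- by case: h1; exact: smZ.
- by rewrite mulr0.
Qed.

(** The argument for sums carries over, integrability also being invariant under scaling by [c] and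
    [c^-1]. *)
Lemma cintegralZl d (T : measurableType d) (nu : {measure set T -> \bar R})
    (f : T -> C) (c : C) : c != 0 ->
  cintegral nu (fun x => c * f x) = c * cintegral nu f.
Proof.
pose int (g : T -> C) := nu.-integrable setT (fun x => (complex.Re (g x))%:E) /\
         nu.-integrable setT (fun x => (complex.Im (g x))%:E).
have ZT := fun a g => @integrableZl _ T R nu setT measurableT a g.
have intZ (a : C) g : int g -> int (fun x => a * g x).
  move=> [gr gi]; split.
  - under eq_fun do rewrite ReM EFinB 2!EFinM.
    by have := integrableB measurableT (ZT (complex.Re a) _ gr)
      (ZT (complex.Im a) _ gi); exact.
  - under eq_fun do rewrite ImM EFinD 2!EFinM.
    by have := integrableD measurableT (ZT (complex.Re a) _ gi)
      (ZT (complex.Im a) _ gr); exact.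
move=> c0; rewrite /cintegral; case: asboolP => h1; case: asboolP => h2.
- have [fr fi] := h2; rewrite complex_mulE -!RintegralZl//.
  rewrite -RintegralB//; [|exact: ZT fr|exact: ZT fi].
  rewrite -RintegralD//; [|exact: ZT fi|exact: ZT fr].
  by congr (_ +i* _)%C; apply: eq_Rintegral => x _; rewrite ?ReM ?ImM.
- case: h2; have := intZ c^-1 _ h1; congr int.
  by apply/funext => x; rewrite mulKf.
- by case: h1; exact: intZ.
- by rewrite mulr0.
Qed.

End ComplexSums.

(** * Rotations and their action on the Eisenstein integral *)

Lemma det_mx22 (A : comPzRingType) (M : 'M[A]_2) :
  \det M = M 0 0 * M 1 1 - M 0 1 * M 1 0.
Proof.
rewrite (expand_det_row M ord0) !big_ord_recl big_ord0 addr0 /cofactor !det_mx11 !mxE.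
rewrite expr0 mul1r expr1 mulN1r mulrN.
by congr (_ * M _ _ - M _ _ * M _ _); exact/val_inj.
Qed.

Section Rotation.
Variable R : realType.
Local Notation C := R[i].

Lemma cexp_i (x : R) : cexp ('i%C * x%:C%C) = (cos x +i* sin x)%C.
Proof.
rewrite /cexp ReM ImM /= !(mul0r, mulr0, mul1r) subr0 add0r expR0.
by rewrite complex_mulE/= !mul1r !mul0r subr0 addr0.
Qed.

Lemma cexp_i_neq0 (x : R) : cexp ('i%C * x%:C%C) != 0.
Proof.
rewrite cexp_i eq_complex /=; apply/negP => /andP[/eqP c0 /eqP s0].
by have /eqP := cos2Dsin2 x; rewrite c0 s0 expr0n addr0 eq_sym oner_eq0.
Qed.

(** De Moivre's formula, which gives the exponential the form of the power in [phi_real]. *)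
Lemma cexp_natmul (k : nat) (t : R) :
  cexp ('i%C * (k%:R * t)%:C%C) = (cos t +i* sin t)%C ^+ k.
Proof.
rewrite cexp_i; elim: k => [|k IH]; first by rewrite mul0r cos0 sin0.
rewrite exprSr -IH -natr1 mulrDl mul1r cosD sinD complex_mulE/=.
by congr (_ +i* _)%C; ring.
Qed.

(** The arguments are the coordinates of [rot (- t)] applied to [(v1, v2)]: the inverse rotation
    acts on vectors, whence the positive sign in the exponential. *)
Lemma phi_real_rot (k : nat) (t v1 v2 : R) :
  phi_real k (cos t * v1 - sin t * v2) (sin t * v1 + cos t * v2) =
  cexp ('i%C * (k%:R * t)%:C%C) * phi_real k v1 v2.
Proof.
rewrite cexp_natmul /phi_real mulrCA -exprMn; congr (_%:C%C * _ ^+ _).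
  have e : (cos t * v1 - sin t * v2) ^+ 2 + (sin t * v1 + cos t * v2) ^+ 2 =
    (cos t ^+ 2 + sin t ^+ 2) * (v1 ^+ 2 + v2 ^+ 2) by ring.
  by rewrite e cos2Dsin2 mul1r.
by rewrite complex_mulE/=; congr (_ +i* _)%C; ring.
Qed.

Variable F : fieldExtType rat.

Lemma adelic_rot_inf (theta : realEmb F R -> R) i j f :
  (adelic_rot theta i j).1 f = Defs.rot (theta f) i j.
Proof. by rewrite [adelic_rot _ _ _]mxE. Qed.

Lemma adelic_rot_fin (theta : realEmb F R -> R) i j :
  (adelic_rot theta i j).2 = (1%:M : 'M[finAdele F]_2) i j.
Proof. by rewrite [adelic_rot _ _ _]mxE. Qed.

Lemma phi_adelic_rot (phi_f : 'cV[finAdele F]_2 -> C)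
   (k : realEmb F R -> nat) (theta : realEmb F R -> R) (w : 'cV[adele F R]_2) :
  phi_adelic phi_f k (uinv (adelic_rotation theta) *m w) =
  (\prod_f cexp ('i%C * ((k f)%:R * theta f)%:C%C)) * phi_adelic phi_f k w.
Proof.
have wE i : (uinv (adelic_rotation theta) *m w) i 0 =
    adelic_rot (\- theta) i 0 * w 0 0 + adelic_rot (\- theta) i 1 * w 1 0.
  by rewrite mxE !big_ord_recl big_ord0 addr0; congr (_ + _ i _ * w _ _); exact/val_inj.
rewrite /phi_adelic mulrCA -big_split/=; congr (_ * _).
  (* At the finite places the rotation is the identity, so the argument of [phi_f] is unchanged. *)
  congr phi_f; apply/colP => i; rewrite [LHS]mxE [RHS]mxE wE.
  transitivity ((adelic_rot (\- theta) i 0).2 * (w 0 0).2 +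
    (adelic_rot (\- theta) i 1).2 * (w 1 0).2); first by [].
  rewrite !adelic_rot_fin !mxE.
  have [->|->] : i = 0 \/ i = 1.
    by case: i => -[|[|//]] ?; [left|right]; exact: val_inj.
  - by rewrite /= mul1r mul0r addr0.
  - by rewrite /= mul1r mul0r add0r.
apply: eq_bigr => f _; rewrite -phi_real_rot !wE.
have arE i : (adelic_rot (\- theta) i 0 * w 0 0 + adelic_rot (\- theta) i 1 * w 1 0).1 f =
    Defs.rot (- theta f) i 0 * (w 0 0).1 f + Defs.rot (- theta f) i 1 * (w 1 0).1 f.
  by rewrite -!(adelic_rot_inf (\- theta)).
by rewrite !arE !mxE /= cosN sinN opprK mulNr.
Qed.

Lemma det_adelic_rot (theta : realEmb F R -> R) : \det (adelic_rot theta) = 1.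
Proof.
rewrite det_mx22; apply/pair_eqP/andP; split; apply/eqP.
  apply/funext => f.
  transitivity (Defs.rot (theta f) 0 0 * Defs.rot (theta f) 1 1 -
    Defs.rot (theta f) 0 1 * Defs.rot (theta f) 1 0).
    by rewrite -!adelic_rot_inf.
  by rewrite !mxE /= mulrN opprK -!expr2 cos2Dsin2.
transitivity ((1%:M : 'M[finAdele F]_2) 0 0 * (1%:M : 'M[finAdele F]_2) 1 1 -
    (1%:M : 'M[finAdele F]_2) 0 1 * (1%:M : 'M[finAdele F]_2) 1 0).
  by rewrite -!(adelic_rot_fin theta).
by rewrite !mxE /= mulr1 mulr0 subr0.
Qed.

(** The inverse of a product reverses the factors, so the inverse rotation acts last, directly under
    [phi], and each term of the sum acquires the factor [c]. *)
Lemma Theta_rot (g : GL2A F R) (phi : 'cV[adele F R]_2 -> C) (theta : realEmb F R -> R)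
    (c : C) : c != 0 ->
  (forall w, phi (uinv (adelic_rotation theta) *m w) = c * phi w) ->
  Theta phi (unitM g (adelic_rotation theta)) = c * Theta phi g.
Proof.
move=> c0 phic; rewrite /Theta -csumZl//; congr csum; apply/funext => w.
by rewrite -phic mulmxA.
Qed.

Lemma gl2_det_rot (g : GL2A F R) (theta : realEmb F R -> R) :
  gl2_det (unitM g (adelic_rotation theta)) = gl2_det g.
Proof.
apply: units_ext; rewrite /gl2_det /unitM /uval -mulmxE det_mulmx.
by rewrite det_adelic_rot mulr1.
Qed.

Lemma unitMA (A : pzRingType) (x y z : unitsOf A) :
  unitM x (unitM y z) = unitM (unitM x y) z.
Proof. by apply: units_ext; rewrite /= mulrA. Qed.

(** The rotation has determinant 1, which fixes the norm factor, and it multiplies on the right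
    while the scalar [t^-1] multiplies on the left, so [Theta_rot] applies under the integral. *)
Lemma Eint_rot (nu : {measure set (borel_class F R) -> \bar R})
    (omega : idele F R -> C) (phi : 'cV[adele F R]_2 -> C) (theta : realEmb F R -> R)
    (c : C) (g : GL2A F R) (s : C) : c != 0 ->
  (forall w, phi (uinv (adelic_rotation theta) *m w) = c * phi w) ->
  Eint nu omega phi (unitM g (adelic_rotation theta)) s = c * Eint nu omega phi g s.
Proof.
move=> c0 phic; rewrite /Eint gl2_det_rot.
rewrite mulrCA; apply: (congr1 ( *%R _)).
rewrite -(cintegralZl _ _ _ nu _ _ c0).
apply: (congr1 (cintegral nu)); apply/funext => x; cbv zeta.
by rewrite unitMA (Theta_rot _ _ _ _ c0 phic) [RHS]mulrCA.
Qed.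

End Rotation.

Theorem mainTheorem6 (R : realType) (F : fieldExtType rat)
  (mu : {measure set (borel_idele F R) -> \bar R})
  (nu : {measure set (borel_class F R) -> \bar R})
  (omega : idele F R -> R[i])
  (k : realEmb F R -> nat)
  (phi_f : 'cV[finAdele F]_2 -> R[i])
  (theta : realEmb F R -> R) :
  totally_real F R ->
  is_haar mu ->
  is_quotient_measure mu nu ->
  unitary_hecke omega ->
  locally_constant phi_f ->
  compactly_supported phi_f ->
  forall g : GL2A F R,
    mero_eq
      (Eana nu omega (phi_adelic phi_f k) (unitM g (adelic_rotation theta)))
      (fun s => (\prod_(f : realEmb F R)
                   cexp ('i%C * ((k f)%:R * theta f)%:C%C)) *
                Eana nu omega (phi_adelic phi_f k) g s).
Proof.
move=> _ _ _ _ _ _ g.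
have c0 : \prod_(f : realEmb F R) cexp ('i%C * ((k f)%:R * theta f)%:C%C) != 0.
  by apply/prodf_neq0 => f _; exact: cexp_i_neq0.
have phic := phi_adelic_rot _ _ phi_f k theta.
(* Unfolding [Eana] turns both sides into choices from [continuations] with the bound 1. *)
exact (continuation_scale _ 1 _ _ _ c0
  (fun s => Eint_rot _ _ nu omega _ theta _ g s c0 phic)).
Qed.
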